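(* Let $f_1,f_2,f_3,f_4\in\mathbb{C}[x,y]$ be pairwise non-proportional binary quadratic forms with $f_1^3+f_2^3=f_3^3+f_4^3$ and $f_1+f_2=T(f_3+f_4)$, where $T\in\mathbb{C}$ with $T(T^3-1)\neq0$, and let $\lambda\in\mathbb{C}$ with $T=\lambda^2$. Then there is an invertible linear change $M$ such that $\{f_1\circ M,f_2\circ M\}=\{F_{3,\lambda},-F_{5,\lambda}\}$ and $\{f_3\circ M,f_4\circ M\}=\{-F_{4,\lambda},F_{6,\lambda}\}$.
   Context: $\omega=e^{2\pi i/3}$. A linear change is $M(x,y)=(\alpha x+\beta y,\gamma x+\delta y)$ with $\alpha\delta-\beta\gamma\neq0$, and $(f\circ M)(x,y)=f(\alpha x+\beta y,\gamma x+\delta y)$. For $\lambda\in\mathbb{C}$: $F_{3,\lambda}=\lambda^3\omega^2x^2-xy+\lambda^3\omega y^2$, $F_{4,\lambda}=-\lambda\omega^2x^2+\lambda^4xy-\lambda\omega y^2$, $F_{5,\lambda}=\lambda^3\omega x^2-xy+\lambda^3\omega^2y^2$, $F_{6,\lambda}=-\lambda\omega x^2+\lambda^4xy-\lambda\omega^2y^2$. *)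

(* Defs.v *)
From HB Require Import structures.
From mathcomp Require Import all_boot all_order all_algebra.
From mathcomp Require Import complex mpoly.
From mathcomp Require Import reals trigo.

Set Implicit Arguments.
Unset Strict Implicit.
Unset Printing Implicit Defensive.

Import GRing.Theory Num.Theory.
Local Open Scope ring_scope.

(* The complex numbers are R[i] for R : realType (a complete archimedean
   ordered field, hence a copy of the reals). *)

Definition omega (R : realType) : R[i] :=
  (cos (2 * pi / 3) +i* sin (2 * pi / 3))%C.

Definition varx (R : realType) : {mpoly R[i][2]} := 'X_(0 : 'I_2).
Definition vary (R : realType) : {mpoly R[i][2]} := 'X_(1 : 'I_2).

(* The zero polynomial is 2.-homog, so it counts as a quadratic form. *)
Definition quadratic_form (R : realType) (f : {mpoly R[i][2]}) : Prop :=
  f \is 2.-homog.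

(* The disjunction makes the relation symmetric; the zero form is
   proportional to every form. *)
Definition proportional (R : realType) (f g : {mpoly R[i][2]}) : Prop :=
  exists c : R[i], f = c *: g \/ g = c *: f.

Definition pairwise_nonproportional (R : realType)
    (f1 f2 f3 f4 : {mpoly R[i][2]}) : Prop :=
  (~ proportional f1 f2 /\ ~ proportional f1 f3 /\ ~ proportional f1 f4) /\
  (~ proportional f2 f3 /\ ~ proportional f2 f4) /\
  ~ proportional f3 f4.

(* M = [[alpha, beta], [gamma, delta]] stands for the map
   (x, y) |-> (alpha x + beta y, gamma x + delta y). *)
Definition linear_change (R : realType) (M : 'M[R[i]]_2)
    (f : {mpoly R[i][2]}) : {mpoly R[i][2]} :=
  f \mPo [tuple M 0 0 *: varx R + M 0 1 *: vary R;
                M 1 0 *: varx R + M 1 1 *: vary R].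

Definition F3 (R : realType) (l : R[i]) : {mpoly R[i][2]} :=
  (l ^+ 3 * omega R ^+ 2) *: varx R ^+ 2 - varx R * vary R
  + (l ^+ 3 * omega R) *: vary R ^+ 2.

Definition F4 (R : realType) (l : R[i]) : {mpoly R[i][2]} :=
  - (l * omega R ^+ 2) *: varx R ^+ 2 + l ^+ 4 *: (varx R * vary R)
  - (l * omega R) *: vary R ^+ 2.

Definition F5 (R : realType) (l : R[i]) : {mpoly R[i][2]} :=
  (l ^+ 3 * omega R) *: varx R ^+ 2 - varx R * vary R
  + (l ^+ 3 * omega R ^+ 2) *: vary R ^+ 2.

Definition F6 (R : realType) (l : R[i]) : {mpoly R[i][2]} :=
  - (l * omega R) *: varx R ^+ 2 + l ^+ 4 *: (varx R * vary R)
  - (l * omega R ^+ 2) *: vary R ^+ 2.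

(* Main.v *)
Require Import Defs.
From HB Require Import structures.
From mathcomp Require Import all_boot all_order all_algebra.
From mathcomp Require Import complex mpoly.
From mathcomp Require Import reals trigo.
From mathcomp Require Import ring lra.

(* Put S = f3 + f4, D = f3 - f4, d = f1 - f2, A = D - lambda d and
   B = D + lambda d. Since f1 + f2 = T S, dividing the equation in cubes by S
   gives (T^3 - 1) S^2 = 3 A B. If a linear factor of A were to occur only once
   in A, both factors of A would divide S, so that A, B and S would all be
   proportional, contradicting the non-proportionality of f3 and f4. Hence
   A = p^2, B = q^2 and S = e p q for independent linear forms p and q, and one
   linear change sending p and q to suitable multiples of x - y and x + y
   carries (S, A, B) to the triple attached to the forms F_i. *)

Set Implicit Arguments.
Unset Strict Implicit.
Unset Printing Implicit Defensive.

Import GRing.Theory Num.Theory.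
Local Open Scope ring_scope.

(** * Binary linear and quadratic forms in coordinates *)

Definition linform (C : nzRingType) (a b : C) : {mpoly C[2]} :=
  a *: 'X_0 + b *: 'X_1.

Definition quadform (C : nzRingType) (a b c : C) : {mpoly C[2]} :=
  a *: 'X_0 ^+ 2 + b *: ('X_0 * 'X_1) + c *: 'X_1 ^+ 2.

Lemma linformM (C : comNzRingType) (p1 p2 q1 q2 : C) :
  linform p1 p2 * linform q1 q2 =
  quadform (p1 * q1) (p1 * q2 + p2 * q1) (p2 * q2).
Proof. by rewrite /linform /quadform -!mul_mpolyC; ring. Qed.

Lemma linformZ (C : comNzRingType) (k p1 p2 : C) :
  k *: linform p1 p2 = linform (k * p1) (k * p2).
Proof. by rewrite /linform -!mul_mpolyC; ring. Qed.

Lemma quadformZ (C : comNzRingType) (k a b c : C) :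
  k *: quadform a b c = quadform (k * a) (k * b) (k * c).
Proof. by rewrite /quadform -!mul_mpolyC; ring. Qed.

Lemma meval_linform (C : comNzRingType) (v : 'I_2 -> C) (p1 p2 : C) :
  (linform p1 p2).@[v] = p1 * v 0 + p2 * v 1.
Proof. by rewrite /linform mevalD !mevalZ !mevalXU. Qed.

Lemma meval_quadform (C : comNzRingType) (v : 'I_2 -> C) (a b c : C) :
  (quadform a b c).@[v] = a * v 0 ^+ 2 + b * (v 0 * v 1) + c * v 1 ^+ 2.
Proof.
by rewrite /quadform !mevalD !mevalZ !mevalM !mevalXU.
Qed.

Lemma homog2_quadform (C : nzRingType) (f : {mpoly C[2]}) :
  f \is 2.-homog -> exists a b c, f = quadform a b c.
Proof.
move=> hf; exists f@_(U_(0%R) *+ 2)%MM, f@_(U_(0%R) + U_(1%R))%MM,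
  f@_(U_(1%R) *+ 2)%MM.
apply/mpolyP=> m.
rewrite /quadform !mcoeffD !mcoeffZ !mpolyXn -mpolyXD !mcoeffX.
have [m2|] := eqVneq (mdeg m) 2; last first.
  move=> m2; rewrite (dhomog_nemf_coeff hf m2).
  have nm k : mdeg k = 2 -> (k == m) = false.
    by move=> hk; apply: contraNF m2 => /eqP <-; apply/eqP.
  by rewrite !nm ?mdegMn ?mdegD ?mdeg1 // !mulr0 !addr0.
have eqm k : (k == m) = (k 0 == m 0) && (k 1 == m 1).
  apply/eqP/andP => [-> // | [/eqP e0 /eqP e1]]; apply/mnmP => i.
  have [->|->] // : i = 0 \/ i = 1.
  by case: i => [[|[|//]] ?]; [left | right]; apply: val_inj.
have : m 0 + m 1 = 2.
  rewrite -m2 mdegE big_ord_recl big_ord1; congr (_ + m _)%N.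
  exact: val_inj.
have e (a b : nat) (k : 'X_{1..2}) :
    k 0 = a -> k 1 = b -> m 0 = a -> m 1 = b -> f@_m = f@_k.
  move=> ? ? ? ?; congr (mcoeff _ _); apply/esym/eqP; rewrite eqm.
  by apply/andP; split; apply/eqP; congruence.
rewrite !eqm !mulmnE !mnmDE !mnm1E /=.
case E0 : (m 0) => [|[|[|//]]]; case E1: (m 1) => [|[|[|//]]] // _;
  rewrite ?mulr0 ?mulr1 ?addr0 ?add0r.
- by apply: e E0 E1; rewrite mulmnE !mnm1E.
- by apply: e E0 E1; rewrite mnmDE !mnm1E.
- by apply: e E0 E1; rewrite mulmnE !mnm1E.
Qed.

(** The quadratic formula, with [d] a square root of the discriminant; for [a = 0] the second
    variable is a factor. *)
Lemma quadform_factor (C : numClosedFieldType) (a b c : C) :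
  exists p1 p2 q1 q2, quadform a b c = linform p1 p2 * linform q1 q2.
Proof.
have [->|a0] := eqVneq a 0.
  by exists 0, 1, b, c; rewrite linformM; congr quadform; ring.
have [d hd] : exists d : C, d ^+ 2 = b ^+ 2 - 4 * a * c.
  by exists (sqrtC (b ^+ 2 - 4 * a * c)); rewrite sqrtCK.
exists a, ((b + d) / 2), 1, ((b - d) / (2 * a)).
rewrite linformM; congr quadform; first by ring.
  by field.
have -> : c = (b ^+ 2 - d ^+ 2) / (4 * a) by rewrite hd; field.
by field.
Qed.

Lemma quadform_roots (C : fieldType) (s0 s1 s2 p1 p2 q1 q2 : C) :
  p1 * q2 - p2 * q1 != 0 ->
  s0 * p2 ^+ 2 - s1 * (p1 * p2) + s2 * p1 ^+ 2 = 0 ->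
  s0 * q2 ^+ 2 - s1 * (q1 * q2) + s2 * q1 ^+ 2 = 0 ->
  exists k, quadform s0 s1 s2 = k *: (linform p1 p2 * linform q1 q2).
Proof.
(* Expanding (x, y) in the basis (p2, - p1), (q2, - q1) of the two roots turns
   a quadratic form s into a combination of q^2, p^2 and p q, with coefficients
   P, Q and l up to the factor (p1 q2 - p2 q1)^-2. *)
set P := s0 * _ - _ + _; set Q := s0 * q2 ^+ 2 - _ + _ => det_neq0 hP hQ.
pose l := - (2 * s0 * p2 * q2 - s1 * (p2 * q1 + p1 * q2) + 2 * s2 * p1 * q1).
exists (l / (p1 * q2 - p2 * q1) ^+ 2).
rewrite linformM quadformZ.
(* [u], [w] and [a] are to be the matching coefficients of q^2, p^2 and p q. *)
have cert u w s a : (p1 * q2 - p2 * q1) ^+ 2 * s = u * P + w * Q + l * a ->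
    s = l / (p1 * q2 - p2 * q1) ^+ 2 * a.
  rewrite hP hQ !mulr0 !add0r => h.
  by rewrite mulrAC -h mulrAC mulfV ?mul1r // expf_neq0.
congr quadform.
- by apply: (cert (q1 ^+ 2) (p1 ^+ 2)); rewrite /P /Q /l; ring.
- by apply: (cert (2 * q1 * q2) (2 * p1 * p2)); rewrite /P /Q /l; ring.
- by apply: (cert (q2 ^+ 2) (p2 ^+ 2)); rewrite /P /Q /l; ring.
Qed.

Lemma linform_colinear (C : fieldType) (p1 p2 q1 q2 : C) :
  p1 * q2 - p2 * q1 = 0 -> linform p1 p2 != 0 ->
  exists k, linform q1 q2 = k *: linform p1 p2.
Proof.
move=> /subr0_eq det0 p_neq0.
have [p10|p1_neq0] := eqVneq p1 0.
  have p2_neq0 : p2 != 0.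
    by apply: contraNneq p_neq0 => p20; rewrite p10 p20 /linform !scale0r addr0.
  exists (q2 / p2); rewrite linformZ; congr linform; last by rewrite mulfVK.
  by apply: (mulfI p2_neq0); rewrite -det0 p10 mul0r !mulr0.
exists (q1 / p1); rewrite linformZ; congr linform; first by rewrite mulfVK.
by apply: (mulfI p1_neq0); rewrite det0; field.
Qed.

(** * Products of two quadratic forms that are squares up to a scalar *)

(** A zero of [A] is a zero of [S ^+ 2], hence of [S]. Independent factors of [A] give [S] two
    distinct roots, which determine it up to a scalar; dependent factors make [A] a scalar times a
    square, and the scalar has a square root. *)
Lemma quadform_split_or_square (C : numClosedFieldType) (A B S : {mpoly C[2]})
    (c : C) :
  A \is 2.-homog -> S \is 2.-homog -> A != 0 -> S ^+ 2 = c *: (A * B) ->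
  (exists k, S = k *: A) \/ (exists p1 p2, A = linform p1 p2 ^+ 2).
Proof.
move=> /homog2_quadform[a0 [a1 [a2 ->]]] /homog2_quadform[s0 [s1 [s2 ->]]].
have [p1 [p2 [q1 [q2 ->]]]] := quadform_factor a0 a1 a2.
rewrite mulf_eq0 => /norP[p0 q0] hS.
have root (u v : C) : (p1 * u + p2 * v) * (q1 * u + q2 * v) = 0 ->
    s0 * u ^+ 2 + s1 * (u * v) + s2 * v ^+ 2 = 0.
  move=> uv0; pose w (i : 'I_2) := if i == 0 then u else v.
  have := congr1 (meval w) hS.
  rewrite expr2 mevalM -expr2 mevalZ !mevalM meval_quadform.
  rewrite !meval_linform /w /= uv0.
  by rewrite mul0r mulr0 => /eqP; rewrite sqrf_eq0 => /eqP.
have [det0|det_neq0] := eqVneq (p1 * q2 - p2 * q1) 0; [right | left].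
  have [k ->] := linform_colinear det0 p0.
  exists (sqrtC k * p1), (sqrtC k * p2).
  by rewrite -linformZ exprZn sqrtCK expr2 scalerAr.
apply: quadform_roots => //.
  by rewrite -(root p2 (- p1)); ring.
by rewrite -(root q2 (- q1)); ring.
Qed.

(** The dichotomy is applied to [A] and, by symmetry, to [B]; the product of the two squares then
    gives [S] up to a sign, which [e] absorbs. *)
Lemma square_eq_mul_squares (C : numClosedFieldType) (A B S : {mpoly C[2]})
    (c : C) :
  A \is 2.-homog -> B \is 2.-homog -> S \is 2.-homog -> c != 0 -> S != 0 ->
  S ^+ 2 = c *: (A * B) -> ~ (exists u v, A = u *: S /\ B = v *: S) ->
  exists p1 p2 q1 q2 e, [/\ A = linform p1 p2 ^+ 2, B = linform q1 q2 ^+ 2,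
    S = e *: (linform p1 p2 * linform q1 q2), e ^+ 2 = c
    & p1 * q2 - p2 * q1 != 0].
Proof.
move=> hA hB hS c0 S0 hSAB hprop.
have A0 : A != 0.
  apply: contra_neq S0 => A0; apply/eqP.
  by rewrite -sqrf_eq0 hSAB A0 mul0r scaler0.
have B0 : B != 0.
  apply: contra_neq S0 => B0; apply/eqP.
  by rewrite -sqrf_eq0 hSAB B0 mulr0 scaler0.
(* One relation [S = k *: E] suffices: cancelling [S] in [S ^+ 2 = c *: (E * F)] makes [F] a
   multiple of [S] too. *)
have nprop (E F : {mpoly C[2]}) k : S ^+ 2 = c *: (E * F) -> S = k *: E ->
    exists u v, E = u *: S /\ F = v *: S.
  move=> hEF hk; have k0 : k != 0.
    by apply: contra_neq S0 => k0; rewrite hk k0 scale0r.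
  exists k^-1, (k / c); split; first by rewrite hk scalerA mulVf ?scale1r.
  apply: (mulfI S0); rewrite -scalerAr -expr2 hEF hk.
  by rewrite scalerA -scalerAl mulrVK ?unitfE.
have [[k hk]|[p1 [p2 hp]]] := quadform_split_or_square hA hS A0 hSAB.
  by case: hprop; apply: nprop hSAB hk.
have hSBA : S ^+ 2 = c *: (B * A) by rewrite mulrC in hSAB *.
have [[k hk]|[q1 [q2 hq]]] := quadform_split_or_square hB hS B0 hSBA.
  by case: hprop; have [u [v [? ?]]] := nprop _ _ _ hSBA hk; exists v, u.
have [e [hSe he]] :
    exists e, S = e *: (linform p1 p2 * linform q1 q2) /\ e ^+ 2 = c.
  have /eqP : S ^+ 2 = (sqrtC c *: (linform p1 p2 * linform q1 q2)) ^+ 2.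
    by rewrite exprZn sqrtCK exprMn -hp -hq.
  rewrite eqf_sqr => /orP[] /eqP ->; [exists (sqrtC c) | exists (- sqrtC c)].
    by rewrite sqrtCK.
  by rewrite scaleNr sqrrN sqrtCK.
exists p1, p2, q1, q2, e; split=> //.
(* If q = k p, then S = e k p^2 is a multiple of [A], the excluded case. *)
apply/eqP => det0; apply: hprop.
have p_neq0 : linform p1 p2 != 0.
  by apply: contraNneq A0 => p0; rewrite hp p0 expr0n.
have [k hk] := linform_colinear det0 p_neq0.
apply: (nprop _ _ (e * k) hSAB).
by rewrite hSe hk hp -scalerA -scalerAr.
Qed.

(** * Linear changes of variables and normal forms *)

(** [M] solves P M = N, where P has rows [(p1, p2)], [(q1, q2)] and N has rows [(a, - a)], [(b, b)];
    its entries come from Cramer's formulas. *)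
Lemma linear_change_exists (R : realType) (p1 p2 q1 q2 a b : R[i]) :
  p1 * q2 - p2 * q1 != 0 -> a != 0 -> b != 0 ->
  exists M : 'M[R[i]]_2,
    [/\ M 0 0 * M 1 1 - M 0 1 * M 1 0 != 0,
        linear_change M (linform p1 p2) = linform a (- a)
      & linear_change M (linform q1 q2) = linform b b].
Proof.
set d := _ - _ => d0 a0 b0.
pose m00 := (a * q2 - p2 * b) / d; pose m01 := (- a * q2 - p2 * b) / d.
pose m10 := (p1 * b - q1 * a) / d; pose m11 := (p1 * b + q1 * a) / d.
pose M : 'M[R[i]]_2 := \matrix_(i, j)
  if i == 0 then if j == 0 then m00 else m01 else if j == 0 then m10 else m11.
have change r1 r2 : linear_change M (linform r1 r2) =
    linform (r1 * m00 + r2 * m10) (r1 * m01 + r2 * m11).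
  rewrite /linear_change /linform comp_mpolyD !comp_mpolyZ.
  rewrite !comp_mpolyXU /= !mxE /=.
  by rewrite /varx /vary -!mul_mpolyC; ring.
exists M; split.
- rewrite !mxE /= (_ : _ - _ = 2 * a * b / d).
    by rewrite !mulf_neq0 ?invr_eq0 ?pnatr_eq0.
  by rewrite /m00 /m01 /m10 /m11 /d; field.
- by rewrite change; congr linform; rewrite /m00 /m01 /m10 /m11 /d; field.
- by rewrite change; congr linform; rewrite /m00 /m01 /m10 /m11 /d; field.
Qed.

(** With t = 2 pi / 3, the angle 2 t is 2 pi - t, so sin t = - 2 cos t sin t; as sin t > 0, this
    gives cos t = - 1/2. *)
Lemma omega_sqr (R : realType) : omega R ^+ 2 = - 1 - omega R.
Proof.
rewrite /omega; set t := 2 * pi / 3.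
have s_gt0 : 0 < sin t.
  apply: sin_gt0_pi; rewrite /t; have := pi_gt0 R => ?; apply/andP; split; lra.
have h : sin t = - (cos t * sin t *+ 2).
  rewrite -sin_mulr2n (_ : t *+ 2 = - t + pi *+ 2) ?sinD2pi ?sinN ?opprK //.
  by rewrite /t; field.
have c : cos t = - 2^-1.
  by apply: (mulIf (lt0r_neq0 s_gt0)); lra.
have s2 := sin2cos2 t; rewrite c in s2.
by apply/eqP; rewrite expr2 eq_complex /= c; apply/andP; split; apply/eqP; nra.
Qed.

Lemma linear_changeD (R : realType) (M : 'M[R[i]]_2) f g :
  linear_change M (f + g) = linear_change M f + linear_change M g.
Proof. exact: comp_mpolyD. Qed.

Lemma linear_changeZ (R : realType) (M : 'M[R[i]]_2) k f :
  linear_change M (k *: f) = k *: linear_change M f.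
Proof. exact: comp_mpolyZ. Qed.

Lemma linear_changeM (R : realType) (M : 'M[R[i]]_2) f g :
  linear_change M (f * g) = linear_change M f * linear_change M g.
Proof. exact: rmorphM. Qed.

(** Keeping the factor [k] lets a form be recovered from [S], [A] and [B] without dividing by 4 or 4
    lambda. *)
Lemma linear_change_combination (R : realType) (M : 'M[R[i]]_2)
    (k s u v : R[i]) (f g S A B : {mpoly R[i][2]}) :
  k != 0 -> k *: f = s *: S + u *: A + v *: B ->
  k *: g = s *: linear_change M S + u *: linear_change M A
    + v *: linear_change M B ->
  linear_change M f = g.
Proof.
move=> k0 hf hg; apply: (scalerI k0).
by rewrite hg -linear_changeZ hf !linear_changeD !linear_changeZ.
Qed.

(** The condition on [gamma ^+ 2] says that the target triple satisfies the same relation as [S],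
    [A] and [B]. *)
Lemma simultaneous_normal_form (R : realType) (A B S : {mpoly R[i][2]})
    (c alpha beta gamma : R[i]) :
  quadratic_form A -> quadratic_form B -> quadratic_form S ->
  S != 0 -> S ^+ 2 = c *: (A * B) ->
  ~ (exists u v, A = u *: S /\ B = v *: S) ->
  c != 0 -> gamma != 0 -> gamma ^+ 2 = c * alpha * beta ->
  exists M : 'M[R[i]]_2,
    [/\ M 0 0 * M 1 1 - M 0 1 * M 1 0 != 0,
        linear_change M S = gamma *: (varx R ^+ 2 - vary R ^+ 2),
        linear_change M A = alpha *: (varx R - vary R) ^+ 2
      & linear_change M B = beta *: (varx R + vary R) ^+ 2].
Proof.
move=> hA hB hS S0 hSAB hprop c0 gamma0 hgamma.
have [p1 [p2 [q1 [q2 [e [hp hq hSe he det0]]]]]] :=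
  square_eq_mul_squares hA hB hS c0 S0 hSAB hprop.
have e0 : e != 0 by rewrite -sqrf_eq0 he.
have beta0 : beta != 0.
  apply: contra_neq gamma0 => beta0; apply/eqP.
  by rewrite -sqrf_eq0 hgamma beta0 mulr0.
pose b := sqrtC beta; have hb : b ^+ 2 = beta := sqrtCK beta.
have b0 : b != 0 by rewrite -sqrf_eq0 hb.
(* Only [b] is chosen as a square root. Fixing [a] by [e * (a * b) = gamma] gives the image of [S]
   its correct sign, and [a ^+ 2 = alpha] follows. *)
pose a := gamma / (e * b).
have a0 : a != 0 by rewrite mulf_neq0 // invr_eq0 mulf_neq0.
have hab : e * (a * b) = gamma by rewrite /a; field; apply/andP.
have ha : a ^+ 2 = alpha.
  apply: (mulIf beta0); apply: (mulfI c0).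
  by rewrite [RHS]mulrA -hgamma -hab -he -hb; ring.
have [M [detM hMp hMq]] := linear_change_exists det0 a0 b0.
have linl : linform a (- a) = a *: (varx R - vary R).
  by rewrite /linform scaleNr scalerBr.
have linr : linform b b = b *: (varx R + vary R) by rewrite /linform scalerDr.
exists M; split=> //.
- rewrite hSe linear_changeZ linear_changeM hMp hMq linl linr -hab.
  by rewrite -scalerAl -scalerAr !scalerA -mulrA -subr_sqr.
- by rewrite hp expr2 linear_changeM hMp linl -expr2 exprZn ha.
- by rewrite hq expr2 linear_changeM hMq linr -expr2 exprZn hb.
Qed.

(* [:: a; b] =i [:: c; d] is equality of the sets {a, b} and {c, d}. *)
Theorem theorem4p3 (R : realType) (f1 f2 f3 f4 : {mpoly R[i][2]})
    (T lambda : R[i])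
    (hf1 : quadratic_form f1) (hf2 : quadratic_form f2)
    (hf3 : quadratic_form f3) (hf4 : quadratic_form f4)
    (hnp : pairwise_nonproportional f1 f2 f3 f4)
    (hcubes : f1 ^+ 3 + f2 ^+ 3 = f3 ^+ 3 + f4 ^+ 3)
    (hsum : f1 + f2 = T *: (f3 + f4))
    (hT : T * (T ^+ 3 - 1) != 0)
    (hlambda : T = lambda ^+ 2) :
  exists M : 'M[R[i]]_2,
    [/\ M 0 0 * M 1 1 - M 0 1 * M 1 0 != 0,
        [:: linear_change M f1; linear_change M f2]
          =i [:: F3 lambda; - F5 lambda]
      & [:: linear_change M f3; linear_change M f4]
          =i [:: - F4 lambda; F6 lambda]].
Proof.
have lambda0 : lambda != 0.
  by apply: contraNneq hT => l0; rewrite hlambda l0 expr0n mul0r.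
have T1 : lambda ^+ 6 - 1 != 0.
  by move: hT; rewrite mulf_eq0 hlambda -exprM => /norP[].
have four_neq0 : (4 : R[i]) != 0 by rewrite pnatr_eq0.
have [_ [_ np34]] := hnp.
pose S : {mpoly R[i][2]} := f3 + f4.
pose A : {mpoly R[i][2]} := f3 - f4 - lambda *: (f1 - f2).
pose B : {mpoly R[i][2]} := f3 - f4 + lambda *: (f1 - f2).
have hf1S : f1 = lambda ^+ 2 *: S - f2 by rewrite -hlambda -hsum addrK.
have S0 : S != 0.
  apply/eqP => S0; apply: np34; exists (- 1); left.
  by rewrite scaleN1r; apply/eqP; rewrite -addr_eq0; apply/eqP.
have hSAB : S ^+ 2 = (3 / (lambda ^+ 6 - 1)) *: (A * B).
  apply: (scalerI T1); rewrite scalerA mulrCA mulfV // mulr1.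
  apply/eqP; rewrite -subr_eq0; apply/eqP; apply: (mulfI S0).
  (* After multiplication by [S], the claim is four times the equation in cubes, with [f1]
     eliminated by [hf1S]. *)
  transitivity (4 *: (f1 ^+ 3 + f2 ^+ 3 - (f3 ^+ 3 + f4 ^+ 3))).
    by rewrite /A /B hf1S /S -!mul_mpolyC; ring.
  by rewrite hcubes subrr scaler0 mulr0.
have c0 : 3 / (lambda ^+ 6 - 1) != 0.
  by rewrite mulf_neq0 ?invr_eq0 ?pnatr_eq0.
have hAh : A \is 2.-homog by rewrite !(rpredB, rpredZ).
have hBh : B \is 2.-homog by rewrite !(rpredB, rpredD, rpredZ).
have hSh : S \is 2.-homog by rewrite rpredD.
(* These invert the definitions: B - A = 2 lambda (f1 - f2) and A + B = 2 (f3 - f4). *)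
have ef1 : (4 * lambda) *: f1 = (2 * lambda ^+ 3) *: S + (- 1) *: A + 1 *: B.
  by rewrite /A /B hf1S -!mul_mpolyC; ring.
have ef2 : (4 * lambda) *: f2 = (2 * lambda ^+ 3) *: S + 1 *: A + (- 1) *: B.
  by rewrite /A /B hf1S -!mul_mpolyC; ring.
have ef3 : 4 *: f3 = 2 *: S + 1 *: A + 1 *: B.
  by rewrite /A /B /S -!mul_mpolyC; ring.
have ef4 : 4 *: f4 = 2 *: S + (- 1) *: A + (- 1) *: B.
  by rewrite /A /B /S -!mul_mpolyC; ring.
have hprop : ~ exists u v, A = u *: S /\ B = v *: S.
  move=> [u [v [hAu hBv]]]; apply: np34.
  have quarter (k : R[i]) : 4 * (k / 4) = k by field.
  have e3 : f3 = ((2 + u + v) / 4) *: S.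
    apply: (scalerI four_neq0).
    by rewrite [RHS]scalerA quarter ef3 hAu hBv -!mul_mpolyC; ring.
  have e4 : f4 = ((2 - u - v) / 4) *: S.
    apply: (scalerI four_neq0).
    by rewrite [RHS]scalerA quarter ef4 hAu hBv -!mul_mpolyC; ring.
  (* The ratio of [f4] to [f3] divides by this coefficient; if it vanishes, [f3] is zero. *)
  have [k0|k0] := eqVneq ((2 + u + v) / 4) 0.
    by exists 0; left; rewrite e3 k0 !scale0r.
  exists ((2 - u - v) / 4 / ((2 + u + v) / 4)); right.
  by rewrite e3 scalerA mulfVK.
pose w := omega R; have ww : w ^+ 2 = - 1 - w := omega_sqr R.
(* The number [w ^+ 2 - w] is - i sqrt 3. *)
have g2 : (w ^+ 2 - w) ^+ 2 = - 3.
  rewrite ww; transitivity (4 * w ^+ 2 + 4 * w + 1); first by ring.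
  by rewrite ww; ring.
have g0 : w ^+ 2 - w != 0 by rewrite -sqrf_eq0 g2 oppr_eq0 pnatr_eq0.
(* The constants are read off the target forms: F6 - F4 is gamma (x^2 - y^2), and - F4 - F6 -/+
   lambda (F3 + F5) are alpha (x - y)^2 and beta (x + y)^2. *)
have hgamma : (lambda * (w ^+ 2 - w)) ^+ 2 = 3 / (lambda ^+ 6 - 1) *
    (lambda * (lambda ^+ 3 - 1)) * (- lambda * (1 + lambda ^+ 3)).
  by rewrite exprMn g2; field.
have gamma0 : lambda * (w ^+ 2 - w) != 0 by rewrite mulf_neq0.
have [M [detM hMS hMA hMB]] :=
  simultaneous_normal_form hAh hBh hSh S0 hSAB hprop c0 gamma0 hgamma.
(* Replacing [w ^+ 2] by [- 1 - w] leaves polynomial identities; the forms match in order, with no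
   swap inside a pair. *)
have c1 : linear_change M f1 = F3 lambda.
  apply: (linear_change_combination _ ef1); first by rewrite mulf_neq0.
  by rewrite hMS hMA hMB /F3 -/w ww -!mul_mpolyC; ring.
have c2 : linear_change M f2 = - F5 lambda.
  apply: (linear_change_combination _ ef2); first by rewrite mulf_neq0.
  by rewrite hMS hMA hMB /F5 -/w ww -!mul_mpolyC; ring.
have c3 : linear_change M f3 = - F4 lambda.
  apply: (linear_change_combination _ ef3) => //.
  by rewrite hMS hMA hMB /F4 -/w ww -!mul_mpolyC; ring.
have c4 : linear_change M f4 = F6 lambda.
  apply: (linear_change_combination _ ef4) => //.
  by rewrite hMS hMA hMB /F6 -/w ww -!mul_mpolyC; ring.
by exists M; rewrite c1 c2 c3 c4.
Qed.
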